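(* Let $(s_r, t) \in \{ (6,3), (8,4), (8,5), (9,6), (12,7), (12,8), (12,9), (12,10), (13,11), (14,13) \}$ and let $s$ be an integer. If $s \ge s_r$, then $\mu(C_s \Box C_t) = 3t$.
   Context: All graphs are finite, simple and undirected. For a graph $G$ and $M \subseteq V(G)$, a shortest $u,v$-path $P$ of $G$ is called $M$-unhindered if $P$ does not contain a vertex of $M \setminus \{u,v\}$. Vertices $u,v \in M$ are $M$-visible if $G$ admits an $M$-unhindered (shortest) $u,v$-path. The set $M$ is a mutual-visibility set of $G$ if its vertices are pairwise $M$-visible. The mutual-visibility number $\mu(G)$ is the size of a largest mutual-visibility set of $G$. The Cartesian product $G \Box H$ has vertex set $V(G)\times V(H)$, with $(x_1,x_2)$ and $(y_1,y_2)$ adjacent whenever $x_1y_1\in E(G)$ and $x_2=y_2$, or $x_2y_2\in E(H)$ and $x_1=y_1$. $C_t$ ($t\ge 3$) denotes the cycle on $t$ vertices $\{0,1,\ldots,t-1\}$. *)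

(* Defs.v *)
From mathcomp Require Import all_boot.
From mathcomp Require Import boolp.

Set Implicit Arguments.
Unset Strict Implicit.
Unset Printing Implicit Defensive.

Record sgraph := SGraph {
  vertex :> finType;
  adj : rel vertex;
  adj_sym : symmetric adj;
  adj_irrefl : irreflexive adj
}.

Section MutualVisibility.
Variable G : sgraph.
Implicit Types (u v : G) (p q : seq G) (M : {set G}).

(* As in path.v, a path with first vertex u is represented by the sequence p
   of its remaining vertices, so that its length is size p. *)
Definition is_path u v p : bool :=
  [&& path (@adj G) u p, last u p == v & uniq (u :: p)].

Definition shortest_path u v p : Prop :=
  is_path u v p /\ forall q, is_path u v q -> size p <= size q.

Definition unhindered M u v p : Prop :=
  shortest_path u v p /\ {in u :: p, forall x, x \notin M :\: [set u; v]}.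

Definition visible M u v : Prop := exists p, unhindered M u v p.

Definition mutual_visibility_set M : Prop := {in M &, forall u v, visible M u v}.

Definition mu : nat := \max_(M : {set G} | `[< mutual_visibility_set M >]) #|M|.

End MutualVisibility.

Section CartesianProduct.
Variables G H : sgraph.

Definition cart_adj : rel (G * H) := fun x y =>
  (adj x.1 y.1 && (x.2 == y.2)) || (adj x.2 y.2 && (x.1 == y.1)).

Lemma cart_adj_sym : symmetric cart_adj.
Proof.
by move=> x y; rewrite /cart_adj !(adj_sym x.1) !(adj_sym x.2) !(eq_sym y.1)
  !(eq_sym y.2).
Qed.

Lemma cart_adj_irrefl : irreflexive cart_adj.
Proof. by move=> x; rewrite /cart_adj !adj_irrefl. Qed.

Definition cart_prod : sgraph := SGraph cart_adj_sym cart_adj_irrefl.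

End CartesianProduct.

Section Cycle.
Variable n : nat.

(* ordS i is i + 1 modulo n. The condition i != j only matters for n = 1,
   where it excludes a loop; this is the cycle C_n when 3 <= n. *)
Definition cycle_adj : rel 'I_n := fun i j =>
  (i != j) && ((j == ordS i) || (i == ordS j)).

Lemma cycle_adj_sym : symmetric cycle_adj.
Proof. by move=> i j; rewrite /cycle_adj eq_sym orbC. Qed.

Lemma cycle_adj_irrefl : irreflexive cycle_adj.
Proof. by move=> i; rewrite /cycle_adj eqxx. Qed.

Definition cycle_graph : sgraph := SGraph cycle_adj_sym cycle_adj_irrefl.

End Cycle.

(* Main.v *)
Require Import Defs.
From mathcomp Require Import all_boot.
From mathcomp Require Import zify.
From mathcomp Require Import boolp.

Set Implicit Arguments.
Unset Strict Implicit.
Unset Printing Implicit Defensive.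

(** Upper bound. A copy of C_s in C_s [] H is convex: flattening a walk onto the
copy deletes its steps along H, so a shortest path between two vertices of the
copy never leaves it ([layer_convex]). If such a copy contained four vertices of
a mutual-visibility set, in cyclic order x1, x2, x3, x4, a shortest path from x1
to x3 would stay in the copy and hence run through x2 or x4. Each of the t copies
therefore has at most 3 vertices of the set ([mu_cycle_prod_le]).

Lower bound. For each t an explicit set with 3 vertices in every copy of C_s is
given for a smallest length s0 of the long cycle, and it is stretched to all
s >= s0 by inserting empty columns at two places: q of them just before a column
c and p of them between the last column and column 0, where p + q = s - s0 and
p is q or q + 1. A path of the base torus extends to the stretched torus by
prolonging every horizontal step that crosses one of the two cuts. The extended
path meets no further vertex of the set, because the new columns are empty; the
point is that it remains shortest. Let dx <= s0 / 2 be its horizontal extent. If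
it crosses at most one of the cuts its new extent is at most dx + p, and
2 (dx + p) <= s0 + p + q when p = q. When p = q + 1 one has to require
2 dx + 1 <= s0 instead for paths crossing the wrap-around cut, which receives the
larger number of columns. So it is enough that in the base torus every pair is
joined by a shortest path free of other vertices of the set, crossing at most
one cut, and having this one unit of slack if that cut is the wrap-around one.
Shortest paths are monotone staircases, so this is decided by a finite search
([certificate]), and [mu_torus] turns a successful search into the value of mu
for every s >= s0.

The base sets have s0 = s_r, with one exception: for t = 5 the set for s = 8
lacks the slack and serves s = 8 only, and the larger s are obtained from a base
set with s0 = 9. *)

(** * Visibility through walks *)

Section Visibility.
Variable G : sgraph.
Implicit Types (u v : G) (p : seq G) (M : {set G}).

(** Shortening a walk to a simple path only drops vertices, so it keeps the walk
unhindered, and it cannot shorten a walk that is already shortest; vertices need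
not be tracked for repetition below. *)
Lemma visible_of_walk M u v p :
  path (@adj G) u p -> last u p = v ->
  (forall p', path (@adj G) u p' -> last u p' = v -> size p <= size p') ->
  {in p, forall x, x = v \/ x \notin M} -> visible M u v.
Proof.
case/shortenP=> p' p'P p'U p'p <- min_p free_p.
have le_p'p : size p' <= size p.
  by apply: uniq_leq_size => //; case/andP: p'U.
exists p'; split; first split; first by rewrite /is_path p'P eqxx.
  move=> r /and3P[rP /eqP r_last _]; exact: leq_trans le_p'p (min_p _ rP r_last).
move=> x; rewrite !inE => /orP[/eqP->|/p'p /free_p[->|/negbTE->]];
  by rewrite ?eqxx ?orbT ?andbF.
Qed.

Lemma visible_sym M u v : visible M u v -> visible M v u.
Proof.
have rev_is_path (a b : G) r : is_path a b r -> is_path b a (rev (belast a r)).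
  case/and3P=> rP /eqP <- rU; rewrite /is_path rev_path.
  have /eq_path-> : (fun z : G => (@adj G)^~ z) =2 @adj G.
    by move=> x y; rewrite adj_sym.
  rewrite rP /=.
  apply/andP; split.
    by case: r {rP rU} => //= x r; rewrite rev_cons last_rcons.
  by rewrite -(rev_uniq (a :: r)) lastI rev_rcons in rU.
case=> p [[pP min_p] free_p]; exists (rev (belast u p)); split.
  split; first exact: rev_is_path.
  by move=> r /rev_is_path /min_p; rewrite !size_rev !size_belast.
case/and3P: pP => _ /eqP p_last _ x.
rewrite -{1}p_last -mem_rev rev_cons revK -lastI => /free_p.
by rewrite (setUC [set u]).
Qed.

End Visibility.

(** * Convexity of the layers of a Cartesian product *)

Section Layers.
Variables G H : sgraph.

(** The projected walk omits the steps of [w] along [H], so [w] is strictly longer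
as soon as it leaves the layer of its origin. *)
Lemma project_walk (u : G * H) w :
  path (@adj (cart_prod G H)) u w ->
  exists w' : seq G, [/\ path (@adj G) u.1 w', last u.1 w' = (last u w).1,
    size w' <= size w &
    size w' = size w -> {in w, forall z, z.2 = u.2}].
Proof.
elim: w u => [|z w IHw] u /=; first by exists [::].
case/andP=> uz /IHw[w' [w'P w'_last le_w'w eq_w']].
case/orP: uz => /andP[uz /eqP eq_uz].
  exists (z.1 :: w'); split; rewrite //= ?uz //.
  case=> /eq_w' all_w a; rewrite inE => /orP[/eqP->//|/all_w ->//].
exists w'; rewrite eq_uz; split=> //; first exact: leqW.
by move=> eq_ww'; move: le_w'w; rewrite eq_ww' ltnn.
Qed.

Lemma layer_convex (a b : G) (y : H) (w : seq (cart_prod G H)) :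
  @shortest_path (cart_prod G H) (a, y) (b, y) w ->
  {in w, forall z, z.2 = y}.
Proof.
case=> /and3P[wP /eqP w_last _] min_w.
have [w' [w'P w'_last le_w'w eq_w']] := project_walk wP.
apply: (eq_w'); apply/eqP; rewrite eqn_leq le_w'w /=.
move: w'_last; rewrite w_last /= => w'_last.
(* The projection lifted back to the layer competes with w once it is made simple. *)
case/shortenP: w'P w'_last => r rP rU rw' r_last.
have le_rw' : size r <= size w'.
  by apply: uniq_leq_size => //; case/andP: rU.
apply: leq_trans le_rw'.
have lift_path x :
    path (@adj (cart_prod G H)) (x, y) [seq (z, y) | z <- r] = path (@adj G) x r.
  rewrite path_map; apply: eq_path => z z' /=.
  by rewrite /cart_adj /= eqxx andbT adj_irrefl orbF.
rewrite -(size_map (fun z => (z, y) : cart_prod G H)); apply: min_w.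
apply/and3P; split; first by rewrite lift_path.
  by rewrite (last_map (fun z => (z, y))) r_last.
rewrite -[_ :: _]/[seq (z, y) | z <- a :: r] map_inj_uniq //.
by move=> z z' [].
Qed.

End Layers.

(** * At most three vertices in each copy of a cycle *)

Section UpperBound.

Lemma cycle_adjP n (i j : 'I_n) : cycle_adj i j ->
  [\/ j = i.+1 :> nat, i = j.+1 :> nat, i = 0 :> nat /\ j.+1 = n
    | j = 0 :> nat /\ i.+1 = n].
Proof.
have ordS_val (k : 'I_n) :
    ordS k = k.+1 :> nat \/ ordS k = 0 :> nat /\ k.+1 = n.
  have := ltn_ord k; rewrite leq_eqVlt => /orP[/eqP k_max|lt_kn] /=.
    by right; rewrite k_max modnn.
  by left; rewrite modn_small.
case/andP=> _ /orP[/eqP->|/eqP->].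
  by case: (ordS_val i) => [?|?]; [apply: Or41|apply: Or44].
by case: (ordS_val j) => [?|?]; [apply: Or42|apply: Or43].
Qed.

Variables (s : nat) (H : sgraph).
Notation G := (cart_prod (cycle_graph s) H).

(** On a cycle, [a] and [b] separate the vertices strictly between them from the
others, also across the wrap-around. *)
Lemma walk_between (a b : 'I_s) (u : G) (w : seq G) :
  path (@adj G) u w ->
  {in u :: w, forall z : G, z.1 <> a /\ z.1 <> b} ->
  (a < u.1 < b) = (a < (last u w).1 < b).
Proof.
elim: w u => //= z w IHw u /andP[uz wP] avoid.
rewrite -(IHw z wP); last by move=> x xw; apply: avoid; rewrite inE xw orbT.
have [ua ub] : u.1 <> a /\ u.1 <> b by apply: avoid; rewrite mem_head.
have [za zb] : z.1 <> a /\ z.1 <> b.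
  by apply: avoid; rewrite !inE eqxx orbT.
case/orP: uz => /andP[]; last by move=> _ /eqP->.
move=> /cycle_adjP uz _.
have neq (x y : 'I_s) : x <> y -> x != y :> nat.
  by move=> xy; apply/eqP=> /val_inj.
have := ltn_ord a; have := ltn_ord b.
have := ltn_ord u.1; have := ltn_ord z.1.
move: (neq _ _ ua) (neq _ _ ub) (neq _ _ za) (neq _ _ zb) uz; rewrite /=.
by move=> ? ? ? ? [|||[]]; lia.
Qed.

Lemma card_layer_le3 (M : {set G}) (y : H) :
  mutual_visibility_set M -> #|[set x : 'I_s | (x, y) \in M]| <= 3.
Proof.
move=> visM; set A := [set x | _]; rewrite leqNgt; apply/negP=> A_gt3.
have : sorted (relpre val ltn) (enum A).
  rewrite /enum_mem; apply: sorted_filter.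
    by move=> x y' z; apply: ltn_trans.
  by rewrite -enumT -sorted_map val_enum_ord iota_ltn_sorted.
have memA x : x \in enum A -> (x, y) \in M by rewrite mem_enum inE.
move: A_gt3 memA; rewrite cardE.
case: (enum A) => [|x1 [|x2 [|x3 [|x4 l]]]] //= _ memA /and4P[x12 x23 x34 _].
have [w [w_min w_free]] : visible M (x1, y) (x3, y).
  by apply: visM; apply: memA; rewrite !inE eqxx ?orbT.
have w_row := layer_convex w_min.
have [/and3P[wP /eqP w_last _] _] := w_min.
(* x3 lies strictly between x2 and x4 and x1 does not, so w meets x2 or x4. *)
have := walk_between (a := x2) (b := x4) wP.
rewrite w_last /= x23 x34 => absurd.
suff : (x2 < x1 < x4) = true by lia.
apply: absurd => z zw.
have z_row : z.2 = y by move: zw; rewrite inE => /orP[/eqP->|/w_row].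
have zM x : x \in [:: x1, x2, x3, x4 & l] -> x1 != x -> x3 != x -> z.1 <> x.
  move=> /memA xM x1x x3x zx.
  have := w_free z zw; rewrite (surjective_pairing z) zx z_row !inE xM andbT negbK.
  rewrite !xpair_eqE !eqxx !andbT => /orP[] /eqP xx; [move: x1x|move: x3x];
    by rewrite xx eqxx.
by split; apply: zM; rewrite ?inE ?eqxx ?orbT // -(inj_eq val_inj) /=; lia.
Qed.

Lemma mu_cycle_prod_le : mu G <= 3 * #|H|.
Proof.
apply/bigmax_leqP=> M /asboolP visM.
rewrite -sum1_card (partition_big (fun z : G => z.2) xpredT) //=.
rewrite mulnC -sum_nat_const; apply: leq_sum => y _.
rewrite sum1_card; apply: leq_trans (card_layer_le3 y visM).
rewrite -(card_imset _ (f := fun x : 'I_s => (x, y) : G)); last by move=> x x' [].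
apply: subset_leq_card; apply/subsetP=> -[x y'] /andP[/= xM /eqP yy'].
by apply/imsetP; exists x; rewrite ?inE -?yy'.
Qed.

End UpperBound.

(** * Distances in a torus *)

(** Both arguments are meant below [n]; the sum of truncated differences is the
absolute difference. *)
Definition cycle_dist n (i j : nat) :=
  minn (i - j + (j - i)) (n - (i - j + (j - i))).

Lemma cycle_dist_step n (i j k : 'I_n) :
  cycle_adj i j -> cycle_dist n i k <= (cycle_dist n j k).+1.
Proof.
move=> /cycle_adjP ij; rewrite /cycle_dist.
have := ltn_ord i; have := ltn_ord j; have := ltn_ord k.
by case: ij => [|||[]]; lia.
Qed.

(** A step moves in one coordinate only and changes that distance by at most 1.
This bound certifies that a walk of this length is shortest. *)
Lemma torus_dist_le s t (u : cart_prod (cycle_graph s) (cycle_graph t)) w :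
  path (@adj (cart_prod (cycle_graph s) (cycle_graph t))) u w ->
  cycle_dist s u.1 (last u w).1 + cycle_dist t u.2 (last u w).2 <= size w.
Proof.
have step a a' b n : a <= a'.+1 -> a' + b <= n -> a + b <= n.+1 by lia.
elim: w u => [|z w IHw] u /=; first by rewrite /cycle_dist; lia.
case/andP=> uz /IHw {IHw}; move: (last z w) => v.
case/orP: uz => /andP[uz /eqP ->].
  exact: step (cycle_dist_step v.1 uz).
by rewrite !(addnC (cycle_dist s _ _)); apply: step (cycle_dist_step v.2 uz).
Qed.

Section Residues.
Variables (n : nat) (n_gt0 : 0 < n).

Definition residue a : 'I_n := Ordinal (ltn_pmod a n_gt0).

Lemma residueDn a : residue (a + n) = residue a.
Proof. by apply: val_inj; rewrite /= modnDr. Qed.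

Lemma residue_adj a : 1 < n -> cycle_adj (residue a) (residue a.+1).
Proof.
move=> n_gt1.
have ordS_residue : ordS (residue a) = residue a.+1.
  by apply: val_inj; rewrite /= -[in LHS]addn1 modnDml addn1.
rewrite /cycle_adj -ordS_residue eqxx andbT -(inj_eq val_inj) /=.
have := ltn_pmod a n_gt0; move: (a %% n) => b; rewrite leq_eqVlt.
case/orP=> [/eqP b_max|lt_bn]; first by rewrite b_max modnn -lt0n -ltnS b_max.
by rewrite (modn_small lt_bn) ltn_eqF.
Qed.

Lemma cycle_dist_residue a d :
  d.*2 <= n -> cycle_dist n (residue a) (residue (a + d)) = d.
Proof.
move=> le_dn; rewrite /= -(modnDml a).
have := ltn_pmod a n_gt0; move: (a %% n) => b lt_bn.
have -> : (b + d) %% n = if b + d < n then b + d else b + d - n.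
  case: ifPn => [/modn_small//|ge_n].
  by rewrite -{1}(@subnK n (b + d)) ?modnDr ?modn_small //; lia.
by rewrite /cycle_dist; case: ifP; lia.
Qed.

End Residues.

(** * Certified base sets and their stretching *)

Section Certificate.
(* rows lists, for each copy of the long cycle, the columns of its vertices in
   the set; c is the inner cut, just before column c. With slack the set can be
   stretched by an arbitrary number of columns, without it by an even one. *)
Variables (slack : bool) (s0 c : nat) (rows : seq (seq nat)).

(** Columns are unrolled: column [X - s0] is met again as [X] after wrapping. *)
Definition occupied (r : seq nat) X := (X \in r) || (X \in map (addn s0) r).

(** Search for a monotone walk with [n] steps left, of which [dx] go right from
column [X] of row [r] and the others go through the successive rows [rs]. The
last vertex entered (when [n' == 0]) is the target, which belongs to the set and
is therefore exempt from being empty. *)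
Fixpoint staircase n (r : seq nat) (rs : seq (seq nat)) X dx : bool :=
  if n is n'.+1 then
    let enter r' X' := (n' == 0) || ~~ occupied r' X' in
    (if dx is dx'.+1 then enter r X.+1 && staircase n' r rs X.+1 dx'
     else false)
    || (if rs is r' :: rs' then enter r' X && staircase n' r' rs' X dx
        else false)
  else true.

(** A segment that does not wrap around may cross the inner cut; one that wraps
must start after it and stop before meeting it again, and needs the slack. *)
Definition fits x dx :=
  if x + dx < s0 then dx.*2 <= s0
  else [&& c <= x, x + dx < s0 + c & dx.*2 + slack <= s0].

(** The step [k] is 1 or [t - 1], that is, +1 or -1 modulo the number of rows. *)
Definition row_walk k y d := [seq (y + k * i) %% size rows | i <- iota 1 d].

Definition seen_via k d y x dx :=
  (d.*2 <= size rows) &&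
  staircase (dx + d) (nth [::] rows y)
    [seq nth [::] rows z | z <- row_walk k y d] x dx.

Definition seen_right y x y' x' :=
  let t := size rows in
  let dx := if x <= x' then x' - x else x' + s0 - x in
  fits x dx &&
  (seen_via 1 ((y' + t - y) %% t) y x dx
   || seen_via t.-1 ((y + t - y') %% t) y x dx).

(** Searching to the right only is enough: a walk going left from one vertex of a
pair goes right from the other one. *)
Definition all_seen :=
  let I := iota 0 (size rows) in
  all (fun y => all (fun x => all (fun y' => all (fun x' =>
    seen_right y x y' x' || seen_right y' x' y x)
    (nth [::] rows y')) I) (nth [::] rows y)) I.

Definition valid_rows :=
  all (fun r => [&& size r == 3, uniq r & all (fun x => x < s0) r]) rows.

Definition certificate := [&& c < s0, valid_rows & all_seen].

Section Soundness.
Variables p q : nat.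
Hypothesis cert : certificate.

Let s := s0 + p + q.
Let t := size rows.
Hypotheses (s_gt1 : 1 < s) (t_gt1 : 1 < t).
Let s_gt0 : 0 < s := ltnW s_gt1.
Let t_gt0 : 0 < t := ltnW t_gt1.
Notation G := (cart_prod (cycle_graph s) (cycle_graph t)).

Let lt_cs0 : c < s0. Proof. by case/and3P: cert. Qed.

(** The new column of an unrolled base column, after inserting [q] columns before
[c] and [p] before [s0]; adequate up to [s0 + c], where the next cut would come. *)
Definition stretch X := X + (c <= X) * q + (s0 <= X) * p.

Let row (y : 'I_t) := nth [::] rows y.
Let place X (y : 'I_t) : G := (residue s_gt0 (stretch X), y).

Definition stretched_set : {set G} :=
  [set z : G | (z.1 : nat) \in [seq stretch x | x <- nth [::] rows z.2]].
Let M := stretched_set.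

Let rowP y : [/\ size (row y) = 3, uniq (row y) & {in row y, forall x, x < s0}].
Proof.
case/and3P: cert => _ /allP valid _.
have /and3P[/eqP size_r uniq_r /allP lt_r] := valid _ (mem_nth [::] (ltn_ord y)).
by split.
Qed.

Lemma stretch_inj : injective stretch.
Proof. by move=> x x'; rewrite /stretch; lia. Qed.

Lemma stretch_mod X : X < s0 + c ->
  stretch X %% s = if X < s0 then stretch X else X - s0.
Proof.
move=> ltX; case: ifPn => ltXs0; first by rewrite modn_small // /stretch /s; lia.
rewrite -(@modn_small (X - s0) s); last by rewrite /s; lia.
by rewrite -(modnDr (X - s0)); congr (_ %% _); rewrite /stretch /s; lia.
Qed.

Lemma place_wrap x y : x < c -> place (x + s0) y = place x y.
Proof.
move=> ltxc; congr pair; apply: val_inj => /=.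
by rewrite !stretch_mod; [case: ifP; case: ifP; rewrite /stretch|..]; lia.
Qed.

Lemma place_free X y : X < s0 + c -> ~~ occupied (row y) X -> place X y \notin M.
Proof.
move=> ltX; apply: contra; rewrite inE /= stretch_mod // => /mapP[x xr].
have [_ _ /(_ x xr) ltx] := rowP y.
rewrite /occupied; case: ifP => ltXs0; first by move/stretch_inj->; rewrite xr.
move=> Xx; have -> : X = s0 + x by move: Xx; rewrite /stretch; lia.
by rewrite map_f ?orbT.
Qed.

Lemma inserted_free X a y : X.+1 < s0 + c -> stretch X < a < stretch X.+1 ->
  ((residue s_gt0 a, y) : G) \notin M.
Proof.
move=> ltX Xa; rewrite inE /=; apply/negP=> /mapP[x xr].
have [_ _ /(_ x xr) ltx] := rowP y.
rewrite modn_small; first by move: Xa; rewrite /stretch; lia.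
by move: Xa; rewrite /stretch /s; lia.
Qed.

Lemma horizontal_walk a n y :
  let w := [seq (residue s_gt0 b, y) : G | b <- iota a.+1 n] in
  path (@adj G) (residue s_gt0 a, y) w
  /\ last ((residue s_gt0 a, y) : G) w = (residue s_gt0 (a + n), y).
Proof.
elim: n a => [|n IHn] a /=; first by rewrite addn0.
have [walk_n ->] := IHn a.+1.
by rewrite addSnnS walk_n /cart_adj /= residue_adj // eqxx.
Qed.

(** A step from [X] to [X.+1] becomes the horizontal run from [stretch X] to
[stretch X.+1], whose intermediate columns, if any, are inserted ones. *)
Lemma staircase_walk n y ys X dx :
  n = dx + size ys -> path (@adj (cycle_graph t)) y ys -> X + dx < s0 + c ->
  staircase n (row y) [seq row z | z <- ys] X dx ->
  exists w : seq G,
    [/\ path (@adj G) (place X y) w,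
        last (place X y) w = place (X + dx) (last y ys),
        size w = stretch (X + dx) - stretch X + size ys
      & {in w, forall z, z = place (X + dx) (last y ys) \/ z \notin M}].
Proof.
elim: n y ys X dx => [|n IHn] y ys X dx.
  case: dx ys => [|//] [|//] _ _ _ _; exists [::].
  by rewrite addn0 subnn.
move=> n_eq ysP ltX /= /orP[].
  case: dx n_eq ltX => // dx [n_eq] ltX /andP[entry].
  rewrite -addSnnS in ltX *.
  case/(IHn _ _ _ _ n_eq ysP ltX) => w [wP w_last w_size w_free].
  have le_stretch Y d : stretch Y <= stretch (Y + d) by rewrite /stretch; lia.
  have := le_stretch X 1; rewrite addn1 => leX.
  have [runP run_last] :=
    horizontal_walk (stretch X) (stretch X.+1 - stretch X) y.
  rewrite subnKC // in run_last.
  exists ([seq (residue s_gt0 b, y)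
            | b <- iota (stretch X).+1 (stretch X.+1 - stretch X)] ++ w).
  split.
  - by rewrite cat_path runP run_last.
  - by rewrite last_cat run_last.
  - rewrite size_cat size_map size_iota w_size.
    by rewrite addnA; congr (_ + _); have := le_stretch X.+1 dx; lia.
  move=> z; rewrite mem_cat => /orP[/mapP[b]|/w_free//].
  rewrite mem_iota => b_range ->.
  have : b <= stretch X.+1 by lia.
  rewrite leq_eqVlt => /orP[/eqP->|ltb]; last first.
    by right; apply: (@inserted_free X); lia.
  case/orP: entry => [n0|free]; last by right; apply: place_free => //; lia.
  left; case: dx ys n_eq {IHn ysP ltX wP w_last w_size w_free} => [|dx] [|y' ys] /=;
    rewrite ?addn0 //; lia.
case: ys n_eq ysP => //= y' ys n_eq /andP[yy' ysP] /andP[entry].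
have {}n_eq : n = dx + size ys by lia.
case/(IHn _ _ _ _ n_eq ysP ltX) => w [wP w_last w_size w_free].
exists (place X y' :: w); split=> //=.
- by rewrite wP /cart_adj /= eqxx yy' orbT.
- by rewrite w_size addnS.
move=> z; rewrite inE => /orP[/eqP->|/w_free//].
case/orP: entry => [n0|free]; last by right; apply: place_free => //; lia.
left; case: dx ys n_eq {IHn ysP ltX wP w_last w_size w_free} => [|dx] [|y'' ys] /=;
  rewrite ?addn0 //; lia.
Qed.

Lemma card_stretched_set : 3 * t <= #|M|.
Proof.
pose f (iy : 'I_3 * 'I_t) : G := place (nth 0 (row iy.2) iy.1) iy.2.
have f_lt (i : 'I_3) y : nth 0 (row y) i \in row y.
  by apply: mem_nth; have [-> _ _] := rowP y.
have f_mod (i : 'I_3) y : stretch (nth 0 (row y) i) %% s = stretch (nth 0 (row y) i).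
  have [_ _ /(_ _ (f_lt i y)) lt_i] := rowP y.
  by rewrite stretch_mod ?lt_i //; lia.
have f_inj : injective f.
  case=> i y [i' y'] [/= eq_x eq_y]; rewrite -eq_y in eq_x *.
  move: eq_x; rewrite !f_mod => /stretch_inj/eqP.
  have [size_r uniq_r _] := rowP y.
  by rewrite nth_uniq ?size_r // => /eqP/val_inj->.
have <- : #|f @: setT| = 3 * t.
  by rewrite card_imset // cardsT card_prod !card_ord.
apply: subset_leq_card; apply/subsetP=> _ /imsetP[[i y] _ ->].
by rewrite inE /= f_mod map_f.
Qed.

(* The wrap-around cut receives the larger share. *)
Hypotheses (le_qp : q <= p) (le_pq : p <= q + slack).

Lemma seen_via_visible k d (y y' : 'I_t) x x' dx :
  k = 1 \/ k = t.-1 -> fits x dx -> x + dx = x' \/ x + dx = x' + s0 ->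
  x < s0 -> x' < s0 -> (y + k * d) %% t = y' -> seen_via k d y x dx ->
  cycle_dist t y y' = d ->
  visible M (place x y) (place x' y').
Proof.
move=> k_step fit dx_eq ltx ltx' y'_eq /andP[le_d stair] dist_d.
set ys := [seq residue t_gt0 (y + k * i) | i <- iota 1 d].
have resid_y : residue t_gt0 y = y.
  by apply: val_inj; rewrite /= modn_small.
have ysP m : path (@adj (cycle_graph t)) (residue t_gt0 (y + k * m))
    [seq residue t_gt0 (y + k * i) | i <- iota m.+1 d] /\
    last (residue t_gt0 (y + k * m))
      [seq residue t_gt0 (y + k * i) | i <- iota m.+1 d]
    = residue t_gt0 (y + k * (m + d)).
  elim: (d) m => [|e IHe] m; first by rewrite addn0.
  have [IH1 IH2] := IHe m.+1.
  rewrite /= IH1 IH2 addSnnS andbT; split=> //.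
  (* A step of t - 1 is a step of -1: read backwards, it is a successor step. *)
  case: k_step => ->; first by rewrite !mul1n addnS residue_adj.
  rewrite cycle_adj_sym -(residueDn _ (y + t.-1 * m)).
  have -> : y + t.-1 * m + t = (y + t.-1 * m.+1).+1 by rewrite mulnS; lia.
  exact: residue_adj.
have [{}ysP ys_last] := ysP 0.
rewrite muln0 addn0 add0n resid_y in ysP ys_last.
have {}ys_last : last y ys = y' by rewrite ys_last; apply: val_inj.
have ys_size : size ys = d by rewrite size_map size_iota.
have lt_dx : x + dx < s0 + c.
  by move: fit; rewrite /fits; case: ifP => [ltd _|_ /and3P[]//]; lia.
have {}stair : staircase (dx + d) (row y) [seq row z | z <- ys] x dx.
  move: stair; congr staircase; rewrite -!map_comp; exact: eq_map.
rewrite -ys_size in stair.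
have [w [wP w_last w_size w_free]] := staircase_walk erefl ysP lt_dx stair.
have place_x' : place (x + dx) y' = place x' y'.
  by case: dx_eq lt_dx => -> // lt_x'; apply: place_wrap; lia.
rewrite ys_last place_x' in w_last w_free.
apply: (visible_of_walk wP w_last) => // w' w'P w'_last.
have := torus_dist_le w'P; rewrite w'_last -place_x'; apply: leq_trans.
rewrite w_size ys_size.
suff <- : cycle_dist s (residue s_gt0 (stretch x))
            (residue s_gt0 (stretch (x + dx)))
          = stretch (x + dx) - stretch x by rewrite dist_d.
have le_stretch : stretch x <= stretch (x + dx) by rewrite /stretch; lia.
(* The stretched extent is at most half of s: this is where fits and the balance
   between p and q are used. *)
rewrite -[in LHS](subnKC le_stretch) cycle_dist_residue //.
move: fit; rewrite /fits /stretch /s.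
by case: ifP => [lt_s0 ?|? /and3P[? ? ?]]; lia.
Qed.

Lemma seen_right_visible (y y' : 'I_t) x x' :
  x \in row y -> x' \in row y' -> seen_right y x y' x' ->
  visible M (place x y) (place x' y').
Proof.
move=> xr x'r /andP[].
have [_ _ /(_ x xr) ltx] := rowP y.
have [_ _ /(_ x' x'r) ltx'] := rowP y'.
set dx := if _ then _ else _.
have dx_eq : x + dx = x' \/ x + dx = x' + s0.
  by rewrite /dx; case: ifP => ?; [left|right]; lia.
rewrite -/t => fit.
have lty := ltn_ord y; have lty' := ltn_ord y'.
have modt a b : a < t -> b < t ->
    (a + t - b) %% t = if b <= a then a - b else a + t - b.
  move=> lta ltb; case: ifPn => le_ba; last by rewrite modn_small; lia.
  by rewrite -addnBAC // modnDr modn_small; lia.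
case/orP=> seen; have /andP[le_d _] := seen;
  apply: (seen_via_visible _ fit dx_eq ltx ltx' _ seen); rewrite ?modt //; auto.
- case: ifPn => le_yy'; first by rewrite mul1n subnKC // modn_small.
  by rewrite mul1n subnKC ?modnDr ?modn_small; lia.
- by move: le_d; rewrite modt // /cycle_dist -/t; case: ifP; lia.
- case: ifPn => le_yy'.
    have -> : y + t.-1 * (y - y') = (y - y') * t + y' by lia.
    by rewrite modnMDl modn_small.
  have -> : y + t.-1 * (y + t - y') = (y + t - y').-1 * t + y' by nia.
  by rewrite modnMDl modn_small.
- by move: le_d; rewrite modt // /cycle_dist -/t; case: ifP; lia.
Qed.

Lemma stretched_set_visible : mutual_visibility_set M.
Proof.
have memM z : z \in M -> exists x y, x \in row y /\ z = place x y.
  rewrite inE => /mapP[x xr zx]; exists x, z.2; split=> //.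
  rewrite [LHS]surjective_pairing; congr pair; apply: val_inj => /=.
  by rewrite -zx modn_small.
move=> u v /memM[x [y [xr ->]]] /memM[x' [y' [x'r ->]]].
case/and3P: cert => _ _ /allP /(_ (y : nat)).
rewrite mem_iota ltn_ord => /(_ isT) /allP /(_ _ xr) /allP /(_ (y' : nat)).
rewrite mem_iota ltn_ord => /(_ isT) /allP /(_ _ x'r) /orP[].
  exact: seen_right_visible.
by move=> seen; apply: visible_sym; apply: seen_right_visible.
Qed.

End Soundness.

Lemma mu_ge_of_certificate s :
  certificate -> 1 < s0 -> 1 < size rows -> s0 <= s -> (~~ slack -> s = s0) ->
  3 * size rows <= mu (cart_prod (cycle_graph s) (cycle_graph (size rows))).
Proof.
move=> cert s0_gt1 t_gt1 le_s slackP.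
pose n := s - s0.
have s_eq : s = s0 + uphalf n + n./2 by rewrite /n; lia.
have le_pq : uphalf n <= n./2 + slack by rewrite /n; lia.
have le_qp : n./2 <= uphalf n by lia.
have s_gt1 : 1 < s0 + uphalf n + n./2 by lia.
rewrite s_eq; apply: leq_trans (card_stretched_set cert s_gt1 t_gt1) _.
apply: (leq_bigmax_cond (F := fun M : {set _} => #|M|)).
by apply/asboolP; apply: stretched_set_visible.
Qed.

End Certificate.

(** The search settles every larger torus of the same height at once, by a single
computation; without slack it is used for the base torus alone. *)
Lemma mu_torus (slack : bool) s0 c rows s :
  certificate slack s0 c rows -> 1 < s0 -> 1 < size rows -> s0 <= s ->
  (~~ slack -> s = s0) ->
  mu (cart_prod (cycle_graph s) (cycle_graph (size rows))) = 3 * size rows.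
Proof.
move=> cert s0_gt1 t_gt1 le_s slackP; apply/eqP; rewrite eqn_leq.
rewrite (mu_ge_of_certificate cert) // andbT -[in leqRHS](card_ord (size rows)).
exact: mu_cycle_prod_le.
Qed.

(** * The base sets *)

(** In [points_s_t] below, [s] is the base length and [t] the number of rows. These
sets come from a heuristic search for sets that admit a certificate; nothing else
singles them out. *)

Definition points_6_3 : seq (seq nat) :=
  [:: [:: 0; 2; 4]; [:: 0; 2; 4]; [:: 0; 2; 4]].

Definition points_8_4 : seq (seq nat) :=
  [:: [:: 1; 3; 7]; [:: 1; 4; 6]; [:: 0; 4; 6]; [:: 1; 4; 6]].

Definition points_8_5 : seq (seq nat) :=
  [:: [:: 1; 4; 7]; [:: 1; 3; 6]; [:: 0; 3; 5]; [:: 0; 2; 5];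
      [:: 2; 4; 7]].

Definition points_9_5 : seq (seq nat) :=
  [:: [:: 0; 3; 7]; [:: 1; 4; 6]; [:: 0; 4; 7]; [:: 1; 3; 6];
      [:: 1; 4; 7]].

Definition points_9_6 : seq (seq nat) :=
  [:: [:: 1; 4; 7]; [:: 0; 3; 6]; [:: 0; 3; 6]; [:: 2; 5; 8];
      [:: 2; 5; 8]; [:: 1; 4; 7]].

Definition points_12_7 : seq (seq nat) :=
  [:: [:: 0; 5; 8]; [:: 0; 5; 9]; [:: 1; 4; 10]; [:: 2; 6; 9];
      [:: 0; 4; 8]; [:: 2; 6; 10]; [:: 1; 4; 9]].

Definition points_12_8 : seq (seq nat) :=
  [:: [:: 1; 5; 10]; [:: 0; 6; 8]; [:: 1; 5; 9]; [:: 3; 7; 11];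
      [:: 1; 6; 10]; [:: 3; 7; 10]; [:: 2; 5; 9]; [:: 3; 7; 11]].

Definition points_12_9 : seq (seq nat) :=
  [:: [:: 2; 6; 10]; [:: 3; 7; 11]; [:: 1; 5; 9]; [:: 0; 4; 8];
      [:: 2; 6; 10]; [:: 3; 7; 11]; [:: 1; 5; 9]; [:: 3; 7; 11];
      [:: 0; 4; 8]].

Definition points_12_10 : seq (seq nat) :=
  [:: [:: 3; 7; 11]; [:: 1; 5; 9]; [:: 2; 6; 9]; [:: 2; 6; 10];
      [:: 0; 4; 8]; [:: 3; 7; 11]; [:: 1; 5; 9]; [:: 0; 4; 8];
      [:: 2; 6; 10]; [:: 4; 8; 11]].

Definition points_13_11 : seq (seq nat) :=
  [:: [:: 3; 7; 12]; [:: 1; 5; 10]; [:: 3; 8; 12]; [:: 2; 7; 11];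
      [:: 0; 4; 9]; [:: 1; 6; 10]; [:: 4; 8; 12]; [:: 3; 7; 11];
      [:: 1; 5; 9]; [:: 2; 6; 10]; [:: 0; 4; 8]].

Definition points_14_13 : seq (seq nat) :=
  [:: [:: 3; 8; 13]; [:: 0; 4; 9]; [:: 2; 7; 11]; [:: 1; 6; 10];
      [:: 3; 8; 13]; [:: 0; 4; 9]; [:: 2; 6; 12]; [:: 1; 5; 10];
      [:: 3; 7; 11]; [:: 4; 9; 13]; [:: 0; 7; 11]; [:: 2; 6; 12];
      [:: 1; 5; 10]].

Theorem proposition3p9 (sr t s : nat) :
  (sr, t) \in [:: (6, 3); (8, 4); (8, 5); (9, 6); (12, 7); (12, 8); (12, 9);
                  (12, 10); (13, 11); (14, 13)] ->
  sr <= s ->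
  mu (cart_prod (cycle_graph s) (cycle_graph t)) = 3 * t.
Proof.
rewrite !inE !xpair_eqE.
case/or4P=> [||| /or4P[||| /or4P[|||]]] /andP[/eqP-> /eqP->] le_s.
(* The certificates are verified by evaluation. *)
- exact: (@mu_torus true 6 3 points_6_3).
- exact: (@mu_torus true 8 4 points_8_4).
- have [->|s_neq8] := eqVneq s 8; first exact: (@mu_torus false 8 4 points_8_5).
  by apply: (@mu_torus true 9 5 points_9_5); rewrite // ltn_neqAle eq_sym s_neq8.
- exact: (@mu_torus true 9 5 points_9_6).
- exact: (@mu_torus true 12 6 points_12_7).
- exact: (@mu_torus true 12 6 points_12_8).
- exact: (@mu_torus true 12 6 points_12_9).
- exact: (@mu_torus true 12 6 points_12_10).
- exact: (@mu_torus true 13 7 points_13_11).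
- exact: (@mu_torus true 14 7 points_14_13).
Qed.
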